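(* The regression-based dual penalty $$\widetilde{M}(\boldsymbol{\alpha},\mathbf{z})=\sum_{n=0}^{N-1}\sum_{i\in I}\widetilde{\beta}_{n,i}(x_n,a_n)\,b_i(z_{n+1}),\qquad a_n=\alpha_n(x_n),$$ where $\mathcal{B}=\{b_i:i\in I\}$ is a functional basis consisting of functions on $\Xi$ with $\int_\Xi b_i\,d\rho=0$ for all $i\in I$, and $\widetilde{\beta}_{n,i}(x_n,a_n)=\boldsymbol{\phi}_{n,i}(x_n,a_n)^{T}\widetilde{\boldsymbol{\theta}}_{n,i}$ are the estimates produced by the regression algorithm described in the context, is a feasible dual penalty, i.e. $$\mathbb{E}_0\big[\widetilde{M}(\boldsymbol{\alpha},\mathbf{z})\big]=0\qquad\text{for all }\boldsymbol{\alpha}\in\mathbb{A}_{\mathcal{F}}.$$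
   Context: Setting. On a probability space $(\Omega,\mathscr{F},\mathbb{P})$, the evolution of information is described by the natural filtration $\mathcal{F}=\{\mathscr{F}_n:n=0,\dots,N\}$, with $\mathscr{F}_0=\{\emptyset,\Omega\}$ and $\mathscr{F}_N=\mathscr{F}$. The noises $z_1,\dots,z_N$ are i.i.d. with law $\rho$ on $\Xi\subseteq\mathbb{R}^d$; $z_n$ is $\mathscr{F}_n$-measurable and $z_{n+1}$ is independent of $\mathscr{F}_n$. Write $\mathbf{z}=(z_1,\dots,z_N)$ and let $\mathbb{E}_n[\cdot]$ denote expectation with respect to (conditional on) $\mathscr{F}_n$. A finite-horizon Markov decision process has states $x_n\in\mathscr{X}_n$, actions $a_n\in\mathscr{A}_n$, given initial state $x_0$ and dynamics $x_{n+1}=f(x_n,a_n,z_{n+1})$, $n=0,\dots,N-1$, with $f$ a deterministic transition function, rewards $r_n(x_n,a_n)$ for $n<N$ and terminal reward $r_N(x_N)$. Policies. A policy $\boldsymbol{\alpha}=(\alpha_0,\dots,\alpha_{N-1})$ is a sequence of decision rules $\alpha_n:\mathscr{X}_n\to\mathscr{A}_n$, with $a_n=\alpha_n(x_n)$. It is non-anticipative ($\mathcal{F}$-adapted) if each decision rule $\alpha_n$ is $\mathscr{F}_n$-measurable, i.e. the action $a_n$ is chosen only on the basis of the information accumulated up to period $n$. $\mathbb{A}_{\mathcal{F}}$ is the set of all non-anticipative policies, and $\mathbb{A}\supseteq\mathbb{A}_{\mathcal{F}}$ is the set of all policies, including anticipative ones (which may use future information). Feasible dual penalty. A functional $M(\boldsymbol{\alpha},\mathbf{z})$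 of $\boldsymbol{\alpha}\in\mathbb{A}$ and $\mathbf{z}$ is a feasible dual penalty if $\mathbb{E}_0[M(\boldsymbol{\alpha},\mathbf{z})]=0$ for all $\boldsymbol{\alpha}\in\mathbb{A}_{\mathcal{F}}$. $\mathbb{M}_{\mathcal{F}}$ denotes the set of all feasible dual penalties. Optimal value functions. $V_N(x_N)=r_N(x_N)$ and $V_n(x_n)=\sup_{a_n\in\mathscr{A}_n}\{r_n(x_n,a_n)+\mathbb{E}_n[V_{n+1}(x_{n+1})]\}$, $n=N-1,\dots,0$. Basis. $\mathcal{B}=\{b_i:i\in I\}$ denotes a functional basis of $\mathbb{M}_{\mathcal{F}}$ ($I$ may be countable or uncountable), where the $b_i$ are functions on $\Xi$ with $\int_\Xi b_i\,d\rho=0$ for all $i\in I$ (hence $\mathbb{E}[b_i(z_{n+1})]=0$ for all $i$ and $n$). It is supposed that one can expand $V_{n+1}(x_{n+1})-\mathbb{E}[V_{n+1}(x_{n+1})\mid x_n,a_n]=\sum_{i\in I}\beta_{n,i}(x_n,a_n)b_i(z_{n+1})$. The coordinates then satisfy the linear system $\mathbb{E}[V_{n+1}(x_{n+1})b_i(z_{n+1})\mid x_n,a_n]=\sum_{j\in I}\beta_{n,j}(x_n,a_n)\mathbb{E}[b_i(z_{n+1})b_j(z_{n+1})]$, $i\in I$, which is assumed solvable, with solution $\beta_{n,i}(x_n,a_n)=\mathbb{E}[V_{n+1}(x_{n+1})h_i(z_{n+1})\mid x_n,a_n]$, where the $h_i$ are deterministic functions depending only on $\mathcal{B}$. Regression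 algorithm. Inputs: the basis $\mathcal{B}$ and a given suboptimal policy $\widetilde{\boldsymbol{\alpha}}=(\widetilde\alpha_0,\dots,\widetilde\alpha_{N-1})$; for each $n,i$ there is a vector of $K$ regressors $\boldsymbol{\phi}_{n,i}(x_n,a_n)=(\phi^1_{n,i}(x_n,a_n),\dots,\phi^K_{n,i}(x_n,a_n))^T$. (1) Simulate $J$ independent paths $(x_0^j,a_0^j,\dots,x_{N-1}^j,a_{N-1}^j,x_N^j)$, $j=1,\dots,J$, under $\widetilde{\boldsymbol{\alpha}}$ with noise sequences $(z_1^j,\dots,z_N^j)$ and $a_n^j=\widetilde{\alpha}_n(x_n^j)$; set $V_n^j(x_n^j)=\sum_{k=n}^{N-1}r_k(x_k^j,a_k^j)+r_N(x_N^j)$. (2) For $n=0,\dots,N-1$ and $i\in I$ let $\widetilde{\boldsymbol{\theta}}_{n,i}\in\mathbb{R}^K$ be the minimizer over $\boldsymbol{\theta}_{n,i}$ of $\frac1J\sum_{j=1}^J\big(V_{n+1}^j(x_{n+1}^j)h_i(z_{n+1}^j)-\boldsymbol{\phi}_{n,i}(x_n^j,a_n^j)^T\boldsymbol{\theta}_{n,i}\big)^2$. (3) Set $\widetilde{\beta}_{n,i}(x_n,a_n)=\boldsymbol{\phi}_{n,i}(x_n,a_n)^T\widetilde{\boldsymbol{\theta}}_{n,i}$, a function of $(x_n,a_n)$. *)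

(* Defs.v *)
From HB Require Import structures.
From mathcomp Require Import all_boot all_order all_algebra finmap.
From mathcomp Require Import all_classical all_reals all_analysis.
From mathcomp.analysis.showcase Require summability.

Set Implicit Arguments.
Unset Strict Implicit.
Unset Printing Implicit Defensive.

Import Order.TTheory GRing.Theory Num.Theory.
Import numFieldNormedType.Exports.

Local Open Scope classical_set_scope.
Local Open Scope ring_scope.

(* Finite-horizon Markov decision process.  The sets X_n and A_n live in two
   ambient measurable spaces S and A, so that a single transition function
   serves all periods; nothing is assumed outside these sets.  The space R^d is
   d.-tuple R, whose sigma-algebra is the product of the Borel ones. *)
Record mdp dS dA (R : realType) (d : nat)
    (S : measurableType dS) (A : measurableType dA) := MDP {
  horizon : nat ;
  states : nat -> set S ;
  actions : nat -> set A ;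
  noises : set (d.-tuple R) ;
  initial : S ;
  trans : S -> A -> d.-tuple R -> S ;
  reward : nat -> S -> A -> R ;
  terminal_reward : S -> R ;
  measurable_states : forall n, (n <= horizon)%N -> measurable (states n) ;
  measurable_actions : forall n, (n < horizon)%N -> measurable (actions n) ;
  measurable_noises : measurable noises ;
  initial_in : states 0 initial ;
  trans_in : forall n x a xi, (n < horizon)%N ->
    states n x -> actions n a -> noises xi -> states n.+1 (trans x a xi) ;
  measurable_trans : forall n, (n < horizon)%N ->
    measurable_fun (states n `*` actions n `*` noises)
      (fun p => trans p.1.1 p.1.2 p.2)
}.

Section Dynamics.
Context dS dA (R : realType) (d : nat)
  (S : measurableType dS) (A : measurableType dA) (m : mdp R d S A).

(* A realization of the decision rules (alpha_0, ..., alpha_(N-1)). *)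
Definition rules := nat -> S -> A.

(* A realization of the noises: only the entries 1, ..., N are meaningful. *)
Definition noise_seq := nat -> d.-tuple R.

Definition admissible (al : rules) : Prop :=
  forall n x, (n < horizon m)%N -> states m n x -> actions m n (al n x).

Fixpoint state (al : rules) (ze : noise_seq) (n : nat) : S :=
  if n is k.+1 then
    trans m (state al ze k) (al k (state al ze k)) (ze k.+1)
  else initial m.

Definition action (al : rules) (ze : noise_seq) (n : nat) : A :=
  al n (state al ze n).

Definition reward_to_go (al : rules) (ze : noise_seq) (n : nat) : R :=
  \sum_(n <= k < horizon m) reward m k (state al ze k) (action al ze k) +
  terminal_reward m (state al ze (horizon m)).

End Dynamics.

Arguments rules {dS dA} S A.

Section Noise.
Local Open Scope ereal_scope.
Context dW dT (R : realType) (Omega : measurableType dW)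
  (T : measurableType dT) (P : probability Omega R).

Definition mutually_independent (K : finType) (X : K -> {RV P >-> T}) : Prop :=
  forall (D : {set K}) (B : K -> set T), (forall k, measurable (B k)) ->
    P (\bigcap_(k in [set` D]) (X k @^-1` B k)) =
    \prod_(k in D) P (X k @^-1` B k).

Definition iid (K : finType) (rho : probability T R) (Xi : set T)
    (X : K -> {RV P >-> T}) : Prop :=
  [/\ forall k w, Xi (X k w),
      forall k B, measurable B -> distribution P (X k) B = rho B
    & mutually_independent X].

(* sigma(z_1, ..., z_n) *)
Definition natural_filtration (z : nat -> {RV P >-> T}) (n : nat) :
    set (set Omega) :=
  g_sigma_preimage (fun k : 'I_n => z k.+1 : Omega -> T).

Definition independent_of (X : {RV P >-> T}) (G : set (set Omega)) : Prop :=
  forall E B, G E -> measurable B ->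
    P (E `&` X @^-1` B) = P E * P (X @^-1` B).

Record noise_model (N : nat) (rho : probability T R) (Xi : set T)
    (z : nat -> {RV P >-> T}) : Prop := NoiseModel {
  noise_iid : iid rho Xi (fun k : 'I_N => z k.+1) ;
  noise_indep : forall n, (n < N)%N ->
    independent_of (z n.+1) (natural_filtration z n) ;
  filtration_top : natural_filtration z N = @measurable _ Omega
}.

End Noise.

Section Penalties.
Context dS dA dW (R : realType) (d : nat)
  (S : measurableType dS) (A : measurableType dA) (m : mdp R d S A)
  (Omega : measurableType dW) (P : probability Omega R)
  (z : nat -> {RV P >-> d.-tuple R}).

Definition noise_path (w : Omega) : noise_seq R d := fun n => z n w.

(* The decision rules of a general, possibly anticipative, policy may depend
   arbitrarily on the scenario. *)
Definition policies : set (Omega -> rules S A) :=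
  [set al | forall w, admissible m (al w)].

(* A rule matters only through its value at the realized state, i.e. through
   the action a_n, which has to be F_n-measurable. *)
Definition nonanticipative_policies : set (Omega -> rules S A) :=
  [set al | policies al /\
    forall n (B : set A), (n < horizon m)%N -> measurable B ->
      natural_filtration z n
        [set w | B (action m (al w) (noise_path w) n)]].

(* As F_0 is trivial, the expectation given F_0 is the plain expectation; its
   existence is part of the requirement. *)
Definition feasible_penalties : set (rules S A -> noise_seq R d -> R) :=
  [set M | forall al, nonanticipative_policies al ->
    P.-integrable setT (fun w => (M (al w) (noise_path w))%:E) /\
    ('E_P[fun w => M (al w) (noise_path w)] = 0)%E].

End Penalties.

Section Basis.
Context dT (R : realType) (T : measurableType dT) (rho : probability T R)
  (Xi : set T) (I : choiceType) (b : I -> T -> R).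

Definition mean_zero_family : Prop :=
  forall i, rho.-integrable Xi (EFin \o b i) /\
    (\int[rho]_(xi in Xi) (b i xi)%:E = 0)%E.

(* g = sum_(i in I) c_i b_i, the partial sums over the finite subsets of I
   converging (as a net) in L^1(rho).  For uncountable I, and already for
   countable I, pointwise convergence would not preserve the mean. *)
Definition l1_sum (c : I -> R) (g : T -> R) : Prop :=
  measurable_fun Xi g /\
  (fun F : {fset I} => \int[rho]_(xi in Xi)
     (`|g xi - summability.partial_sum (fun i => c i * b i xi) F|)%:E)%E
    @ summability.totally --> 0%E.

End Basis.

Section ValueFunctions.
Context dS dA (R : realType) (d : nat)
  (S : measurableType dS) (A : measurableType dA) (m : mdp R d S A)
  (rho : probability (d.-tuple R) R).

(* z_(n+1) has law rho and is independent of F_n, so that, x_n and a_n being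
   known, E_n[V_(n+1)(x_(n+1))] is an integral against rho.  The equality with
   a real number includes the finiteness of the supremum. *)
Definition value_functions (V : nat -> S -> R) : Prop :=
  (forall x, states m (horizon m) x ->
     V (horizon m) x = terminal_reward m x) /\
  (forall n x, (n < horizon m)%N -> states m n x ->
     (V n x)%:E = ereal_sup
       [set ((reward m n x a)%:E +
             \int[rho]_(xi in noises m) (V n.+1 (trans m x a xi))%:E)%E
       | a in actions m n]).

(* The expansion of V_(n+1)(x_(n+1)) - E[V_(n+1)(x_(n+1)) | x_n, a_n], the
   linear system solved by its coordinates, and the functions h_i solving it.
   In each clause, vn is xi |-> V_(n+1)(f(x_n, a_n, xi)). *)
Definition coordinate_functions (I : choiceType)
    (b h : I -> d.-tuple R -> R) (V : nat -> S -> R)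
    (beta : nat -> I -> S -> A -> R) : Prop :=
  forall n x a, (n < horizon m)%N -> states m n x -> actions m n a ->
  let Xi := noises m in
  let vn := fun xi => V n.+1 (trans m x a xi) in
  [/\ rho.-integrable Xi (EFin \o vn),
      l1_sum rho Xi b (fun i => beta n i x a)
        (fun xi => vn xi - \int[rho]_(ze in Xi) vn ze),
      forall i,
        [/\ rho.-integrable Xi (fun xi => (vn xi * b i xi)%:E),
            forall j, rho.-integrable Xi (fun xi => (b i xi * b j xi)%:E)
          & summability.partial_sum
              (fun j => beta n j x a * \int[rho]_(xi in Xi) (b i xi * b j xi))
              @ summability.totally
              --> \int[rho]_(xi in Xi) (vn xi * b i xi)]
    & forall i, rho.-integrable Xi (fun xi => (vn xi * h i xi)%:E) /\
        beta n i x a = \int[rho]_(xi in Xi) (vn xi * h i xi)].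

End ValueFunctions.

Section Regression.
Context dS dA (R : realType) (d : nat)
  (S : measurableType dS) (A : measurableType dA) (m : mdp R d S A)
  (I : choiceType) (K : nat) (phi : nat -> I -> S -> A -> 'cV[R]_K).

Definition linear_fit (theta : 'cV[R]_K) (n : nat) (i : I) (x : S) (a : A) : R :=
  ((phi n i x a)^T *m theta) 0 0.

Definition empirical_loss (J : nat) (h : I -> d.-tuple R -> R)
    (al : rules S A) (ze : 'I_J -> noise_seq R d) (n : nat) (i : I)
    (theta : 'cV[R]_K) : R :=
  J%:R^-1 * \sum_(j < J)
    (reward_to_go m al (ze j) n.+1 * h i (ze j n.+1) -
     linear_fit theta n i (state m al (ze j) n) (action m al (ze j) n)) ^+ 2.

Definition regression_estimates (J : nat) (h : I -> d.-tuple R -> R)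
    (al : rules S A) (ze : 'I_J -> noise_seq R d)
    (theta : nat -> I -> 'cV[R]_K) : Prop :=
  forall n i, (n < horizon m)%N -> forall theta',
    empirical_loss h al ze n i (theta n i) <= empirical_loss h al ze n i theta'.

(* M(alpha, z) = sum_(n < N) sum_(i in I) beta_(n,i)(x_n, a_n) b_i(z_(n+1)).
   The inner sum is an L^1(rho) limit for every (x_n, a_n), hence defined up to
   rho-null sets: g n x a is a version of it, jointly measurable in (x, a, xi)
   so that it can be evaluated along a random trajectory. *)
Definition dual_penalty (rho : probability (d.-tuple R) R)
    (b : I -> d.-tuple R -> R) (beta : nat -> I -> S -> A -> R)
    (M : rules S A -> noise_seq R d -> R) : Prop :=
  exists g : nat -> S -> A -> d.-tuple R -> R,
    [/\ forall n, (n < horizon m)%N ->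
          measurable_fun (states m n `*` actions m n `*` noises m)
            (fun p => g n p.1.1 p.1.2 p.2),
        forall n x a, (n < horizon m)%N -> states m n x -> actions m n a ->
          l1_sum rho (noises m) b (fun i => beta n i x a) (g n x a)
      & forall al ze, M al ze = \sum_(n < horizon m)
          g n (state m al ze n) (action m al ze n) (ze n.+1)].

End Regression.

(* Main.v *)
(* Each sum over the basis, being an L^1(rho) limit of mean-zero functions, is
   itself rho-integrable with mean zero.  Only the whole penalty is known to be
   integrable along a policy, not its N terms, so the expectation cannot be
   taken term by term.  Instead, the terms are removed one at a time, from the
   last.  If M_(n+1) = M_n + g_n(x_n, a_n, z_(n+1)) is integrable, then, since
   (x_n, a_n, M_n) is F_n-measurable and hence independent of z_(n+1), Fubini's
   theorem for the product of their laws integrates out z_(n+1): the partial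
   integral is M_n, so M_n is integrable with the same mean as M_(n+1).  Down
   at M_0 = 0 the mean is 0. *)

Require Import Defs.
From HB Require Import structures.
From mathcomp Require Import all_boot all_order all_algebra finmap.
From mathcomp Require Import all_classical all_reals all_analysis.
From mathcomp Require Import measurable_realfun.

Set Implicit Arguments.
Unset Strict Implicit.
Unset Printing Implicit Defensive.

Import Order.TTheory GRing.Theory Num.Theory.
Import numFieldNormedType.Exports.

Local Open Scope classical_set_scope.
Local Open Scope ring_scope.

(** Finite partial sums are integrable with mean zero, and some lie arbitrarily close to [g] in L^1:
    distance below 1 already makes [g] integrable, and distance below [e] bounds the absolute value
    of its mean by [e]. *)
Lemma l1_sum_mean_zero dT (R : realType) (T : measurableType dT)
    (rho : probability T R) (Xi : set T) (I : choiceType) (b : I -> T -> R)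
    (c : I -> R) (g : T -> R) :
  measurable Xi -> mean_zero_family rho Xi b -> l1_sum rho Xi b c g ->
  rho.-integrable Xi (EFin \o g) /\ (\int[rho]_(xi in Xi) (g xi)%:E = 0)%E.
Proof.
move=> mXi hb [mg gcvg].
pose ps F xi := summability.partial_sum (fun i => c i * b i xi) F.
have psE F xi :
    (ps F xi)%:E = (\sum_(i : F) (c (val i))%:E * (b (val i) xi)%:E)%E.
  by rewrite /ps /summability.partial_sum -sumEFin.
have ips F : rho.-integrable Xi (EFin \o ps F).
  rewrite (_ : _ \o _ = fun xi =>
      (\sum_(i : F) (c (val i))%:E * (b (val i) xi)%:E)%E); last first.
    by apply/funext => xi; rewrite -psE.
  by apply: integrable_sum => // i _; apply: integrableZl => //; case: (hb (val i)).
have ps0 F : (\int[rho]_(xi in Xi) (ps F xi)%:E = 0)%E.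
  under eq_integral do rewrite psE.
  rewrite integral_sum//; last first.
    by move=> i; apply: integrableZl => //; case: (hb (val i)).
  by apply: big1 => i _; have [ib b0] := hb (val i); rewrite integralZl// b0 mule0.
have dmeas F : measurable_fun Xi (fun xi => g xi - ps F xi).
  apply: measurable_funB => //.
  by have /measurable_int/measurable_EFinP := ips F.
(* The filter [totally] is proper, so some finite [F] exists whose distance falls in the
   neighbourhood [x < e] of 0. *)
have close (e : R) : (0 < e)%R -> exists F,
    (\int[rho]_(xi in Xi) `|(g xi - ps F xi)%:E| < e%:E)%E.
  move=> e0.
  have nb : nbhs (0 : \bar R)%E [set x | (x < e%:E)%E].
    by apply: open_nbhs_nbhs; split; [exact: open_ereal_lt_ereal|rewrite /= lte_fin].
  have [F /= FP] := @filter_ex _ _ (@summability.totally_filter I) _ (gcvg _ nb).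
  by exists F.
have di F : (\int[rho]_(xi in Xi) `|(g xi - ps F xi)%:E| < +oo)%E ->
    rho.-integrable Xi (fun xi => (g xi - ps F xi)%:E).
  by move=> dlt; apply/integrableP; split => //; exact/measurable_EFinP.
have gE F : EFin \o g = (fun xi => (g xi - ps F xi)%:E + (ps F xi)%:E)%E.
  by apply/funext => xi /=; rewrite -EFinD subrK.
have [F1 F1lt] := close 1 ltr01.
have ig : rho.-integrable Xi (EFin \o g).
  rewrite (gE F1); apply: integrableD => //.
    by apply: di; rewrite (lt_trans F1lt)// ltry.
  exact: ips.
split => //.
have fing : (\int[rho]_(xi in Xi) (g xi)%:E)%E \is a fin_num.
  exact: integrable_fin_num.
apply/eqP; rewrite -abse_eq0 eq_le abse_ge0 andbT.
apply/lee_addgt0Pr => e e0; rewrite add0e.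
have [F Flt] := close e e0.
have iF : rho.-integrable Xi (fun xi => (g xi - ps F xi)%:E).
  by apply: di; rewrite (lt_trans Flt)// ltry.
(* Subtracting a partial sum, of mean zero, keeps the integral and brings in the L^1 distance. *)
have -> : (\int[rho]_(xi in Xi) (g xi)%:E =
           \int[rho]_(xi in Xi) (g xi - ps F xi)%:E)%E.
  rewrite -[RHS]adde0 -(ps0 F) -integralD//; last exact: ips.
  by apply: eq_integral => xi _; rewrite -EFinD subrK.
apply: le_trans (ltW Flt); apply: le_abse_integral => //.
exact/measurable_EFinP.
Qed.

(** * Integrating out an independent variable *)

Section independence.
Local Open Scope ereal_scope.
Context dW d1 d2 (R : realType) (Omega : measurableType dW)
  (T1 : measurableType d1) (T2 : measurableType d2) (P : probability Omega R)
  (rho : probability T2 R) (W : {RV P >-> T1}) (Z : {RV P >-> T2}).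
Hypothesis WZ : forall A B, measurable A -> measurable B ->
  P (W @^-1` A `&` Z @^-1` B) = P (W @^-1` A) * rho B.

Let pair_measurable : measurable_fun setT (fun w => (W w, Z w)).
Proof. exact: measurable_fun_pair. Qed.

Let WZp : {RV P >-> (T1 * T2)%type} := mfun_Sub (mem_set pair_measurable).

(** By [WZ] both measures agree on measurable rectangles, which determine the product measure. *)
Lemma independent_law_prod X : measurable X ->
  (distribution P W \x rho) X = distribution P WZp X.
Proof.
by apply: product_measure_unique => A B mA mB; rewrite -WZ.
Qed.

(** Only the slices of [g] are known to be integrable, so the expectation cannot be split. Fubini is
    applied to the whole integrand instead: its partial integral is [u], which inherits
    integrability and mean. *)
Lemma integrable_cancel_mean_zero (u : T1 -> R) (g : T1 * T2 -> R) :
  measurable_fun setT u -> measurable_fun setT g ->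
  (forall x, rho.-integrable setT (fun y => (g (x, y))%:E)) ->
  (forall x, \int[rho]_y (g (x, y))%:E = 0) ->
  P.-integrable setT (fun w => (u (W w) + g (W w, Z w))%:E) ->
  P.-integrable setT (fun w => (u (W w))%:E) /\
  \int[P]_w (u (W w))%:E = \int[P]_w (u (W w) + g (W w, Z w))%:E.
Proof.
move=> mu mg gi g0 ig.
pose f (p : T1 * T2) := (u p.1 + g p)%:E.
have mf : measurable_fun setT f.
  apply/measurable_EFinP/measurable_funD => //.
  exact: measurableT_comp.
have iD : (distribution P WZp).-integrable setT f by exact: integrable_pushforward.
have iX : (distribution P W \x rho).-integrable setT f.
  apply/integrableP; split => //; have /integrableP[_] := iD.
  congr (_ < _); apply: eq_measure_integral => A mA _.
  by symmetry; exact: independent_law_prod.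
(* As [rho] has mass 1, the constant [u x] survives, while the slice of [g] contributes 0. *)
have FE : fubini_F rho f = EFin \o u.
  apply/funext => x; rewrite /fubini_F /f /=.
  under eq_integral do rewrite EFinD.
  rewrite integralD//; last exact: finite_measure_integrable_cst.
  rewrite g0 adde0 integral_cst//.
  transitivity ((u x)%:E * 1); last by rewrite mule1.
  by congr (_ * _); exact: probability_setT.
have iu : (distribution P W).-integrable setT (EFin \o u).
  by rewrite -FE; exact: integrable_fubini_F.
have iuW : P.-integrable setT (fun w => (u (W w))%:E).
  apply/integrableP; split; first exact/measurable_EFinP/measurableT_comp.
  have /integrableP[_] := iu.
  rewrite ge0_integral_distribution//.
  by apply: measurableT_comp => //; exact/measurable_EFinP.
split => //.
transitivity (\int[distribution P W]_x (u x)%:E).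
  by rewrite integral_distribution//; exact/measurable_EFinP.
rewrite -[LHS]/(\int[distribution P W]_x (EFin \o u) x) -FE.
rewrite integral12_prod_meas1//.
rewrite (eq_measure_integral (distribution P WZp)); last first.
  by move=> A mA _; exact: independent_law_prod.
by rewrite integral_distribution.
Qed.

End independence.

(** * The natural filtration and measurability with respect to it *)

Section filtration.
Context dW dT (R : realType) (Omega : measurableType dW)
  (T : measurableType dT) (P : probability Omega R)
  (z : nat -> {RV P >-> T}).

Lemma natural_filtration_measurable n :
  natural_filtration z n `<=` @measurable _ Omega.
Proof.
apply: smallest_sub; first exact: sigma_algebra_measurable.
(* The generating class is a finite union, over ['I_n], of preimage classes, hence the induction on
   the big operator. *)
elim/big_ind : _ => [//|F G FP GP|i _] X; first by case; [exact: FP|exact: GP].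
by case=> B mB <-; exact: measurable_funP.
Qed.

Lemma noise_in_filtration k n B : (k < n)%N -> measurable B ->
  natural_filtration z n (z k.+1 @^-1` B).
Proof.
move=> kn mB; apply: sub_sigma_algebra.
by rewrite (bigD1 (Ordinal kn))//=; left; exists B => //; rewrite setTI.
Qed.

Lemma natural_filtration_mono n n' : (n <= n')%N ->
  natural_filtration z n `<=` natural_filtration z n'.
Proof.
move=> nn'; apply: smallest_sub; first exact: smallest_sigma_algebra.
elim/big_ind : _ => [//|F G FP GP|i _] X; first by case; [exact: FP|exact: GP].
case=> B mB <-; rewrite setTI; apply: noise_in_filtration => //.
exact: leq_trans nn'.
Qed.

(** [Omega] with F_n as its sigma-algebra: being F_n-measurable becomes an ordinary
    [measurable_fun], with all its closure properties. *)
Definition filtered_space (n : nat) : measurableType _ :=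
  g_sigma_algebraType (natural_filtration z n).

Lemma measurable_filtered_spaceE n (B : set Omega) :
  @measurable _ (filtered_space n) B = natural_filtration z n B.
Proof.
by rewrite /measurable/= sigma_algebra_id//; exact: smallest_sigma_algebra.
Qed.

Lemma filtered_measurable_funP n dU (U : measurableType dU)
    (f : filtered_space n -> U) :
  measurable_fun setT f <->
  forall B, measurable B -> natural_filtration z n (f @^-1` B).
Proof.
split=> [mf B mB|mf _ B mB].
  by rewrite -measurable_filtered_spaceE -[_ @^-1` _]setTI; exact: mf.
by rewrite setTI measurable_filtered_spaceE; exact: mf.
Qed.

Lemma filtered_measurable_le n n' dU (U : measurableType dU) (f : Omega -> U) :
  (n <= n')%N -> measurable_fun setT (f : filtered_space n -> U) ->
  measurable_fun setT (f : filtered_space n' -> U).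
Proof.
move=> nn' /filtered_measurable_funP mf; apply/filtered_measurable_funP => B mB.
by apply: (natural_filtration_mono nn'); exact: mf.
Qed.

Lemma filtered_measurable n dU (U : measurableType dU) (f : Omega -> U) :
  measurable_fun setT (f : filtered_space n -> U) -> measurable_fun setT f.
Proof.
move=> /filtered_measurable_funP mf _ B mB; rewrite setTI.
by apply: (@natural_filtration_measurable n); exact: mf.
Qed.

Lemma measurable_noise k n : (k < n)%N ->
  measurable_fun setT (z k.+1 : filtered_space n -> T).
Proof.
by move=> kn; apply/filtered_measurable_funP => B mB; exact: noise_in_filtration.
Qed.

End filtration.

(** * Adapted trajectories and removal of the last penalty term *)

Section trajectories.
Context dS dA dW (R : realType) (d : nat)
  (S : measurableType dS) (A : measurableType dA) (m : mdp R d S A)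
  (Omega : measurableType dW) (P : probability Omega R)
  (z : nat -> {RV P >-> d.-tuple R}) (al : Omega -> rules S A).
Hypothesis zm : forall k w, (k < horizon m)%N -> noises m (z k.+1 w).
Hypothesis alP : nonanticipative_policies m z al.

Local Notation X n w := (state m (al w) (noise_path z w) n).
Local Notation Y n w := (action m (al w) (noise_path z w) n).

Lemma state_in n w : (n <= horizon m)%N -> states m n (X n w).
Proof.
have [adm _] := alP.
elim: n => [_|n IH nN]; first exact: initial_in.
apply: trans_in => //; last exact: zm.
  by apply: IH; exact: ltnW.
by apply: adm => //; apply: IH; exact: ltnW.
Qed.

Lemma action_in n w : (n < horizon m)%N -> actions m n (Y n w).
Proof.
by have [adm _] := alP; move=> nN; apply: adm => //; exact/state_in/ltnW.
Qed.

(** This is non-anticipativity itself: as the rules vary with the scenario, it would not follow from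
    measurability of the state. *)
Lemma measurable_action n : (n < horizon m)%N ->
  measurable_fun setT ((fun w => Y n w) : filtered_space z n -> A).
Proof.
have [_ meas] := alP; move=> nN.
by apply/filtered_measurable_funP => B mB; exact: meas.
Qed.

(** Serves both the next state and the penalty terms. [g] is measurable only on the product of the
    feasible sets, which the trajectory never leaves. *)
Lemma measurable_along n dU (U : measurableType dU)
    (g : S -> A -> d.-tuple R -> U) : (n < horizon m)%N ->
  measurable_fun (states m n `*` actions m n `*` noises m)
    (fun p => g p.1.1 p.1.2 p.2) ->
  measurable_fun setT ((fun w => X n w) : filtered_space z n -> S) ->
  measurable_fun setT
    ((fun w => g (X n w) (Y n w) (z n.+1 w)) : filtered_space z n.+1 -> U).
Proof.
move=> nN mg mX.
have mD : measurable (states m n `*` actions m n `*` noises m).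
  apply: measurableX; last exact: measurable_noises.
  by apply: measurableX; [exact/measurable_states/ltnW|exact: measurable_actions].
apply: (@measurable_comp _ _ _ (filtered_space z n.+1) _ _ _
  (fun p => g p.1.1 p.1.2 p.2) _ (fun w => ((X n w, Y n w), z n.+1 w)) mD _ mg).
  move=> _ [w _ <-]; split; last exact: zm.
  by split; [exact/state_in/ltnW|exact: action_in].
apply: measurable_fun_pair; last exact: measurable_noise.
apply: measurable_fun_pair; first exact: filtered_measurable_le mX.
exact: (filtered_measurable_le (leqnSn n) (measurable_action nN)).
Qed.

Lemma measurable_state n : (n <= horizon m)%N ->
  measurable_fun setT ((fun w => X n w) : filtered_space z n -> S).
Proof.
elim: n => [_|n IH nN]; first exact: measurable_cst.
by apply: (measurable_along nN (measurable_trans nN)); apply: IH; exact: ltnW.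
Qed.

Variable g : nat -> S -> A -> d.-tuple R -> R.
Hypothesis mg : forall n, (n < horizon m)%N ->
  measurable_fun (states m n `*` actions m n `*` noises m)
    (fun p => g n p.1.1 p.1.2 p.2).

Local Notation D k w := (g k (X k w) (Y k w) (z k.+1 w)).

Lemma measurable_partial_penalty n : (n <= horizon m)%N ->
  measurable_fun setT
    ((fun w => \sum_(k < n) D k w) : filtered_space z n -> R).
Proof.
elim: n => [_|n IH nN].
  by under eq_fun do rewrite big_ord0; exact: measurable_cst.
under eq_fun do rewrite big_ord_recr/=.
apply: measurable_funD.
  by apply: (filtered_measurable_le (leqnSn n)); apply: IH; exact: ltnW.
by apply: (measurable_along nN (mg nN)); apply: measurable_state; exact: ltnW.
Qed.

Variable rho : probability (d.-tuple R) R.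
Hypothesis g0 : forall n x a, (n < horizon m)%N ->
  states m n x -> actions m n a ->
  rho.-integrable (noises m) (EFin \o g n x a) /\
  (\int[rho]_(xi in noises m) (g n x a xi)%:E = 0)%E.
Hypothesis zrho : forall n B, (n < horizon m)%N -> measurable B ->
  P (z n.+1 @^-1` B) = rho B.
Hypothesis zind : forall n, (n < horizon m)%N ->
  independent_of (z n.+1) (natural_filtration z n).

Local Open Scope ereal_scope.

Lemma partial_penalty_step n : (n < horizon m)%N ->
  P.-integrable setT (fun w => (\sum_(k < n.+1) D k w)%:E) ->
  P.-integrable setT (fun w => (\sum_(k < n) D k w)%:E) /\
  \int[P]_w (\sum_(k < n) D k w)%:E = \int[P]_w (\sum_(k < n.+1) D k w)%:E.
Proof.
move=> nN.
have nN' := ltnW nN.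
(* All that is known at time n, in one variable: the partial sum is a component, so that [u] can be
   [snd]. *)
pose W w := ((X n w, Y n w), (\sum_(k < n) D k w)%R).
have mWn : measurable_fun setT (W : filtered_space z n -> (S * A * R)%type).
  apply: measurable_fun_pair; last exact: measurable_partial_penalty.
  by apply: measurable_fun_pair; [exact: measurable_state|exact: measurable_action].
have mW : measurable_fun setT W by exact: filtered_measurable mWn.
pose W' : {RV P >-> (S * A * R)%type} := mfun_Sub (mem_set mW).
pose E := states m n `*` actions m n `*` noises m.
have mE : measurable E.
  apply: measurableX; last exact: measurable_noises.
  by apply: measurableX; [exact/measurable_states/ltnW|exact: measurable_actions].
(* Extension by 0 outside [E] makes the term measurable on the whole product space. *)
pose ge := (fun p : S * A * d.-tuple R => g n p.1.1 p.1.2 p.2) \_ E.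
have mge : measurable_fun setT ge.
  exact: ((measurable_restrictT _ mE).1 (mg nN)).
pose h (p : (S * A * R) * d.-tuple R) := ge (p.1.1, p.2).
have mh : measurable_fun setT h.
  apply: measurableT_comp => //; apply: measurable_fun_pair => //.
  by apply: measurableT_comp.
have WZ B C : measurable B -> measurable C ->
    P (W' @^-1` B `&` z n.+1 @^-1` C) = P (W' @^-1` B) * rho C.
  move=> mB mC; rewrite zind ?zrho//.
  by move/filtered_measurable_funP : mWn; exact.
(* At infeasible (x, a) the extended slice is identically 0, so the mean-zero property holds at
   every point. *)
have h0 x : rho.-integrable setT (fun y => (h (x, y))%:E) /\
    \int[rho]_y (h (x, y))%:E = 0.
  have [xin|xout] := pselect ((states m n `*` actions m n) x.1).
    have -> : (fun y => (h (x, y))%:E) =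
        (EFin \o g n x.1.1 x.1.2) \_ (noises m).
      apply/funext => y; rewrite /h /ge !patchE/=.
      have -> : ((x.1, y) \in E) = (y \in noises m).
        by apply/idP/idP; rewrite !inE; [case|split].
      by case: ifP.
    have [i0 e0] := g0 nN xin.1 xin.2.
    split; first by apply/(integrable_mkcond _ (@measurable_noises _ _ _ _ _ _ m)).
    by rewrite -integral_mkcond.
  have -> : (fun y => (h (x, y))%:E) = cst 0.
    by apply/funext => y; rewrite /h /ge patchE memNset//= => -[].
  by split; [exact: integrable0|rewrite integral0].
(* Trajectories stay in [E], so the default value 0 is never taken along them. *)
have sumS w : (\sum_(k < n.+1) D k w)%R =
    ((W' w).2 + h (W' w, z n.+1 w))%R.
  rewrite big_ord_recr/= /h /ge patchE mem_set//=.
  by split; [split; [exact: state_in|exact: action_in]|exact: zm].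
rewrite (funext (fun w => congr1 EFin (sumS w))).
apply: (@integrable_cancel_mean_zero _ _ _ _ _ _ _ P rho W' (z n.+1) WZ snd h) => //.
- by move=> x; have [] := h0 x.
- by move=> x; have [] := h0 x.
Qed.

(** Integrability stays a premise of the induction: given at the horizon, it is handed down from
    [n.+1] to [n] by the step. *)
Lemma penalty_mean_zero :
  P.-integrable setT (fun w => (\sum_(k < horizon m) D k w)%:E) ->
  \int[P]_w (\sum_(k < horizon m) D k w)%:E = 0.
Proof.
suff: forall n, (n <= horizon m)%N ->
    P.-integrable setT (fun w => (\sum_(k < n) D k w)%:E) ->
    \int[P]_w (\sum_(k < n) D k w)%:E = 0 by exact.
elim=> [_ _|n IH nN inS].
  by under eq_integral do rewrite big_ord0; rewrite integral0.
have [iS <-] := partial_penalty_step nN inS.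
by apply: IH => //; exact: ltnW.
Qed.

End trajectories.

Theorem theorem3p1 (R : realType) (d : nat)
  (dS dA dW dW' : measure_display)
  (S : measurableType dS) (A : measurableType dA) (m : mdp R d S A)
  (rho : probability (d.-tuple R) R)
  (Omega : measurableType dW) (P : probability Omega R)
  (z : nat -> {RV P >-> d.-tuple R})
  (hz : noise_model (horizon m) rho (noises m) z)
  (I : choiceType) (b h : I -> d.-tuple R -> R)
  (hb : mean_zero_family rho (noises m) b)
  (V : nat -> S -> R) (hV : value_functions m rho V)
  (beta : nat -> I -> S -> A -> R)
  (hbeta : coordinate_functions m rho b h V beta)
  (K : nat) (phi : nat -> I -> S -> A -> 'cV[R]_K)
  (al0 : rules S A) (hal0 : admissible m al0)
  (J : nat) (hJ : (0 < J)%N)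
  (Omega' : measurableType dW') (P' : probability Omega' R)
  (zs : 'I_J -> nat -> {RV P' >-> d.-tuple R})
  (hzs : iid rho (noises m)
     (fun k : ('I_J * 'I_(horizon m))%type => zs k.1 k.2.+1))
  (w' : Omega') (theta : nat -> I -> 'cV[R]_K)
  (htheta : regression_estimates m phi h al0 (fun j n => zs j n w') theta)
  (M : rules S A -> noise_seq R d -> R)
  (hM : dual_penalty m rho b (fun n i => linear_fit phi (theta n i) n i) M)
  (hMint : forall al, nonanticipative_policies m z al ->
     P.-integrable setT (fun w => (M (al w) (noise_path z w))%:E)) :
  feasible_penalties m z M.
Proof.
move=> al alP; split; first exact: hMint.
have [g [mg gl1 Msum]] := hM.
have [[zm zrho _] zind _] := hz.
rewrite unlock; under eq_integral do rewrite Msum.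
apply: (penalty_mean_zero _ alP mg (rho := rho)) => //.
- by move=> k w kN; exact: (zm (Ordinal kN)).
(* With the sample frozen at [w'] and (x, a) fixed, the regression estimates are constant
   coefficients of an L^1 sum. *)
- move=> n x a nN xin ain; apply: l1_sum_mean_zero hb (gl1 n x a nN xin ain).
  exact: measurable_noises.
- by move=> n B nN mB; exact: (zrho (Ordinal nN)).
- by have := hMint al alP; under eq_fun do rewrite Msum.
Qed.
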